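(* Let $D=\{(x,y,z)\in\mathbb{C}^3 : xy=z^2-1\}$, equipped with its standard algebraic volume form $\omega$ and with the free $\mathbb{Z}_2$-action generated by $\sigma(x,y,z)=(-x,-y,-z)$. Then $D$ has the $\mathbb{Z}_2$-AVDP, i.e. the Lie algebra generated by the $\mathbb{Z}_2$-invariant completely integrable volume preserving algebraic vector fields on $D$ is equal to the Lie algebra of all $\mathbb{Z}_2$-invariant volume preserving algebraic vector fields on $D$.
   Context: The volume form $\omega$ is the nowhere vanishing algebraic 2-form on $D$ given by $\omega=\frac{dx}{x}\wedge dz$ where $x\neq0$ and $\omega=-\frac{dy}{y}\wedge dz$ where $y\neq0$. A vector field $V$ is volume preserving if $L_V\omega=0$, completely integrable if its flow is defined for all complex times and all starting points, and $\mathbb{Z}_2$-invariant if $\sigma_*V=V$. In general, for an affine algebraic manifold $X$ with algebraic volume form and a finite group $\Gamma$ acting freely and algebraically on $X$, the $\Gamma$-AVDP means that the Lie algebra generated by $\Gamma$-invariant completely integrable volume preserving algebraic vector fields on $X$ equals the Lie algebra of all $\Gamma$-invariant volume preserving algebraic vector fields on $X$. *)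

(* Defs.v *)
From HB Require Import structures.
From mathcomp Require Import all_boot all_order all_algebra ring.
From mathcomp Require Import complex.
From mathcomp Require Import boolp classical_sets functions reals topology.
From mathcomp Require Import normedtype derive.
(* mpoly without its notations: they clash with those of MathComp-Analysis *)
From mathcomp Require mpoly.
Import (canonicals, coercions) mpoly.

Set Implicit Arguments.
Unset Strict Implicit.
Unset Printing Implicit Defensive.

Import Order.TTheory GRing.Theory Num.Theory.
Import numFieldNormedType.Exports.

Local Open Scope classical_set_scope.
Local Open Scope complex_scope.
Local Open Scope ring_scope.

Section Surface.
Variable R : realType.
(* the complex numbers, over an arbitrary model R of the reals *)
Local Notation C := R[i].

Definition on_D (a : 'rV[C]_3) : bool := a 0 0 * a 0 1 == a 0 2 ^+ 2 - 1.

Record D : Type := MkD { pt :> 'rV[C]_3 ; pt_on_D : on_D pt }.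

HB.instance Definition _ := [isSub for pt].
HB.instance Definition _ := [Choice of D by <:].

Lemma base_on_D : on_D (delta_mx 0 2).
Proof. by rewrite /on_D !mxE /= mul0r expr1n subrr. Qed.

HB.instance Definition _ := isPointed.Build D (MkD base_on_D).

Lemma opp_on_D (a : D) : on_D (- pt a).
Proof.
by rewrite /on_D !mxE mulrNN sqrrN; exact: pt_on_D.
Qed.

Definition sigma (a : D) : D := MkD (opp_on_D a).

Lemma sigmaK : involutive sigma.
Proof. by move=> a; apply: val_inj => /=; rewrite opprK. Qed.

Lemma sigma_free (a : D) : sigma a <> a.
Proof.
move=> /(congr1 pt) /= aE.
have a0 i : pt a 0 i = 0.
  have : pt a 0 i *+ 2 == 0 by rewrite mulr2n -{1}aE mxE addNr.
  by rewrite mulrn_eq0 /= => /eqP.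
have := pt_on_D a; rewrite /on_D !a0 mul0r expr0n /= sub0r eq_sym oppr_eq0.
by rewrite oner_eq0.
Qed.

(* The coordinate ring C[D]: since D is given as a set of points, its elements
   are the restrictions to D of polynomial functions on C^3. *)
Definition regular_pred : {pred D -> C} :=
  fun f => `[< exists p : mpoly.mpoly 3 C,
                 forall a : D, f a = mpoly.meval (pt a 0) p >].

Lemma regular_subring : subring_closed regular_pred.
Proof.
split.
- by apply/asboolP; exists 1 => a; rewrite mpoly.meval1.
- move=> f g /asboolP[p pE] /asboolP[q qE]; apply/asboolP; exists (p - q) => a.
  by rewrite mpoly.mevalB -pE -qE.
- move=> f g /asboolP[p pE] /asboolP[q qE]; apply/asboolP.
  by exists (p * q) => a; rewrite mpoly.mevalM -pE -qE.
Qed.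

HB.instance Definition _ :=
  GRing.isSubringClosed.Build (D -> C) regular_pred regular_subring.

Lemma regular_scale : GRing.scaler_closed regular_pred.
Proof.
move=> c f /asboolP[p pE]; apply/asboolP; exists (c *: p) => a.
by rewrite mpoly.mevalZ -pE.
Qed.

HB.instance Definition _ :=
  GRing.isScaleClosed.Build C (D -> C) regular_pred regular_scale.

Record regfun : Type :=
  MkRegfun { regfun_val :> D -> C ; regfunP : regfun_val \in regular_pred }.

HB.instance Definition _ := [isSub for regfun_val].
HB.instance Definition _ := [Choice of regfun by <:].
HB.instance Definition _ := [SubChoice_isSubComNzRing of regfun by <:].
HB.instance Definition _ := [SubZmodule_isSubLmodule of regfun by <:].

Lemma regfun_scalerAl (c : C) (f g : regfun) : c *: (f * g) = c *: f * g.
Proof. by apply: val_inj; apply/funext => a; exact: mulrA. Qed.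

HB.instance Definition _ :=
  GRing.Lmodule_isLalgebra.Build C regfun regfun_scalerAl.
HB.instance Definition _ := GRing.Lalgebra_isComAlgebra.Build C regfun.

Lemma regfunB (f g : regfun) a : (f - g) a = f a - g a. Proof. by []. Qed.
Lemma regfunM (f g : regfun) a : (f * g) a = f a * g a. Proof. by []. Qed.
Lemma regfunN (f : regfun) a : (- f) a = - f a. Proof. by []. Qed.

Lemma coord_regular (i : 'I_3) : (fun a : D => pt a 0 i) \in regular_pred.
Proof.
apply/asboolP; exists (mpoly.mpolyX C (mpoly.mnm1 i)) => a.
by rewrite mpoly.mevalXU.
Qed.

Definition coord (i : 'I_3) : regfun := MkRegfun (coord_regular i).
Definition x_ : regfun := coord 0.
Definition y_ : regfun := coord 1.
Definition z_ : regfun := coord 2.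

Lemma xyz_eq : x_ * y_ = z_ ^+ 2 - 1.
Proof.
apply: val_inj; apply/funext => a.
exact/eqP/(pt_on_D a).
Qed.

Lemma sigma_pull_regular (f : regfun) : (f \o sigma) \in regular_pred.
Proof.
have /asboolP[p pE] := regfunP f; apply/asboolP.
pose lq : 3.-tuple (mpoly.mpoly 3 C) :=
  [tuple - mpoly.mpolyX C (mpoly.mnm1 i) | i < 3].
exists (mpoly.comp_mpoly lq p) => a.
rewrite mpoly.comp_mpoly_meval /= pE; apply: mpoly.meval_eq => i.
by rewrite tnth_mktuple mpoly.mevalN mpoly.mevalXU mxE.
Qed.

Definition sigma_pull (f : regfun) : regfun := MkRegfun (sigma_pull_regular f).

Lemma sigma_pullD : {morph sigma_pull : f g / f + g}.
Proof. by move=> f g; exact: val_inj. Qed.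

Lemma sigma_pullM : {morph sigma_pull : f g / f * g}.
Proof. by move=> f g; exact: val_inj. Qed.

Lemma sigma_pull_linear : linear sigma_pull.
Proof. by move=> c f g; exact: val_inj. Qed.

Lemma sigma_pullK : involutive sigma_pull.
Proof. by move=> f; apply: val_inj; apply/funext => a /=; rewrite sigmaK. Qed.

(* Since D is a smooth affine variety, the algebraic vector fields on D (the
   regular sections of its tangent bundle) are the C-linear derivations of its
   coordinate ring. *)
Definition derivation_pred : {pred regfun -> regfun} :=
  fun V => `[< linear V /\ forall f g, V (f * g) = V f * g + f * V g >].

Lemma derivation_submod : submod_closed derivation_pred.
Proof.
split.
- apply/asboolP; have zE f : (0 : regfun -> regfun) f = 0 by [].
  by split=> [c f g|f g]; rewrite !zE ?scaler0 ?mulr0 ?mul0r addr0.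
- move=> c V W /asboolP[Vl VM] /asboolP[Wl WM]; apply/asboolP.
  have cE f : (c *: V + W) f = c *: V f + W f by [].
  split=> [b f g|f g]; rewrite !cE.
    by rewrite Vl Wl !scalerDr addrACA !scalerA mulrC.
  by rewrite VM WM scalerDr mulrDl mulrDr addrACA scalerAl scalerAr.
Qed.

HB.instance Definition _ :=
  GRing.isSubmodClosed.Build C (regfun -> regfun) derivation_pred
    derivation_submod.

Record vfield : Type :=
  MkVfield { vfield_val :> regfun -> regfun ;
             vfieldP : vfield_val \in derivation_pred }.

HB.instance Definition _ := [isSub for vfield_val].
HB.instance Definition _ := [Choice of vfield by <:].
HB.instance Definition _ := [SubChoice_isSubLmodule of vfield by <:].

Lemma vfield_linear (V : vfield) : linear V.
Proof. by have /asboolP[] := vfieldP V. Qed.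

HB.instance Definition _ (V : vfield) :=
  GRing.isLinear.Build C regfun regfun *:%R (vfield_val V) (vfield_linear V).

Lemma vfieldM (V : vfield) f g : V (f * g) = V f * g + f * V g.
Proof. by have /asboolP[_] := vfieldP V; apply. Qed.

Lemma vfieldD (V W : vfield) f : (V + W) f = V f + W f. Proof. by []. Qed.
Lemma vfieldZ c (V : vfield) f : (c *: V) f = c *: V f. Proof. by []. Qed.

Lemma vfield1 (V : vfield) : V 1 = 0.
Proof.
have := vfieldM V 1 1; rewrite !mulr1 mul1r => /eqP.
by rewrite -subr_eq0 opprD addNKr oppr_eq0 => /eqP.
Qed.

Lemma bracket_subproof (V W : vfield) :
  (fun f => V (W f) - W (V f)) \in derivation_pred.
Proof.
apply/asboolP; split=> [c f g|f g].
  by rewrite !vfield_linear scalerBr opprD addrACA.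
rewrite !vfieldM !linearD /= !vfieldM; ring.
Qed.

Definition bracket (V W : vfield) : vfield := MkVfield (bracket_subproof V W).

Lemma fmul_subproof (h : regfun) (V : vfield) :
  (fun f => h * V f) \in derivation_pred.
Proof.
apply/asboolP; split=> [c f g|f g].
  by rewrite linearP mulrDr scalerAr.
rewrite vfieldM; ring.
Qed.

Definition fmul (h : regfun) (V : vfield) : vfield :=
  MkVfield (fmul_subproof h V).

Lemma sigma_push_subproof (V : vfield) :
  (fun f => sigma_pull (V (sigma_pull f))) \in derivation_pred.
Proof.
apply/asboolP; split=> [c f g|f g].
  by rewrite sigma_pull_linear vfield_linear sigma_pull_linear.
by rewrite sigma_pullM vfieldM sigma_pullD !sigma_pullM !sigma_pullK.
Qed.

(* (sigma_* V) f = (V (f o sigma)) o sigma^-1, and sigma^-1 = sigma *)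
Definition sigma_push (V : vfield) : vfield := MkVfield (sigma_push_subproof V).

Definition Z2_invariant (V : vfield) : Prop := sigma_push V = V.

(* The 2-form df /\ dg. Algebraic 2-forms on the smooth affine variety D are
   given by their C[D]-valued evaluation on pairs of algebraic vector fields. *)
Definition dwedge (f g : regfun) (V W : vfield) : regfun :=
  V f * W g - W f * V g.

(* The volume form is the unique algebraic 2-form equal to dx/x /\ dz where
   x <> 0 and to - dy/y /\ dz where y <> 0, two open sets which miss only the
   points (0, 0, 1) and (0, 0, -1) of D: see omegaE_x, omegaE_y and omega_unique.
   This is its polynomial expression, obtained from 1 = z^2 - x y and
   x omega = dx /\ dz, y omega = - dy /\ dz, 2 z omega = dx /\ dy. *)
Definition omega (V W : vfield) : regfun :=
  2%:R^-1 *: (z_ * dwedge x_ y_ V W + x_ * dwedge y_ z_ V W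
              + y_ * dwedge z_ x_ V W).

Lemma vfield_tangent (V : vfield) : V x_ * y_ + x_ * V y_ = 2%:R * z_ * V z_.
Proof.
have := congr1 V xyz_eq; rewrite linearB /= vfield1 expr2 !vfieldM => ->.
ring.
Qed.

Lemma scale_half (f g : regfun) : 2%:R * f = g -> 2%:R^-1 *: g = f.
Proof.
move=> <-; rewrite mulr_natl -(scaler_nat 2 f) scalerA mulVf ?scale1r //.
by rewrite pnatr_eq0.
Qed.

Lemma mul_x_omega V W : x_ * omega V W = dwedge x_ z_ V W.
Proof.
have t (U : vfield) : x_ * U y_ = 2%:R * z_ * U z_ - y_ * U x_.
  by rewrite -vfield_tangent; ring.
rewrite /omega -scalerAr; apply: scale_half; rewrite /dwedge; symmetry.
transitivity (z_ * (V x_ * (x_ * W y_) - W x_ * (x_ * V y_))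
  + x_ * ((x_ * V y_) * W z_ - (x_ * W y_) * V z_)
  + x_ * y_ * (V z_ * W x_ - W z_ * V x_)); first by ring.
rewrite !t.
transitivity ((2%:R * z_ ^+ 2 - 2%:R * (x_ * y_))
  * (V x_ * W z_ - W x_ * V z_)); first by ring.
by rewrite xyz_eq; ring.
Qed.

Lemma mul_y_omega V W : y_ * omega V W = - dwedge y_ z_ V W.
Proof.
have t (U : vfield) : y_ * U x_ = 2%:R * z_ * U z_ - x_ * U y_.
  by rewrite -vfield_tangent; ring.
rewrite /omega -scalerAr; apply: scale_half; rewrite /dwedge; symmetry.
transitivity (z_ * ((y_ * V x_) * W y_ - (y_ * W x_) * V y_)
  + x_ * y_ * (V y_ * W z_ - W y_ * V z_)
  + y_ * (V z_ * (y_ * W x_) - W z_ * (y_ * V x_))); first by ring.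
rewrite !t.
transitivity (- (2%:R * z_ ^+ 2 - 2%:R * (x_ * y_))
  * (V y_ * W z_ - W y_ * V z_)); first by ring.
by rewrite xyz_eq; ring.
Qed.

Lemma mul_z_omega V W : 2%:R * z_ * omega V W = dwedge x_ y_ V W.
Proof.
have t (U : vfield) : 2%:R * z_ * U z_ = U x_ * y_ + x_ * U y_.
  by rewrite vfield_tangent.
rewrite /omega -scalerAr; apply: scale_half; rewrite /dwedge; symmetry.
transitivity (2%:R * z_ ^+ 2 * (V x_ * W y_ - W x_ * V y_)
  + x_ * (V y_ * (2%:R * z_ * W z_) - W y_ * (2%:R * z_ * V z_))
  + y_ * ((2%:R * z_ * V z_) * W x_ - (2%:R * z_ * W z_) * V x_));
  first by ring.
rewrite !t.
transitivity ((2%:R * z_ ^+ 2 - 2%:R * (x_ * y_))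
  * (V x_ * W y_ - W x_ * V y_)); first by ring.
by rewrite xyz_eq; ring.
Qed.

Lemma omegaE_x V W a :
  x_ a != 0 -> omega V W a = dwedge x_ z_ V W a / x_ a.
Proof. by move=> xa; rewrite -mul_x_omega regfunM mulrAC mulfV ?mul1r. Qed.

Lemma omegaE_y V W a :
  y_ a != 0 -> omega V W a = - (dwedge y_ z_ V W a / y_ a).
Proof.
move=> ya; rewrite -mulNr -[- _ a]regfunN -mul_y_omega regfunM mulrAC.
by rewrite mulfV ?mul1r.
Qed.

Lemma poly_vanish (q : {poly C}) : (forall s, s != 0 -> q.[s] = 0) -> q = 0.
Proof.
move=> q0; apply/eqP/contraT => qN0.
have := max_poly_roots (rs := [seq n.+1%:R | n <- iota 0 (size q)]) qN0.
rewrite size_map size_iota ltnn; apply.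
  by apply/allP => _ /mapP[n _ ->]; apply/eqP/q0; rewrite pnatr_eq0.
rewrite map_inj_uniq ?iota_uniq // => m n /eqP.
by rewrite eqr_nat => /eqP[].
Qed.

(* Regular functions are determined outside x = y = 0: the points of that locus
   lie on the lines y = 0, z = +1 or -1. *)
Lemma regfun_vanish (f : regfun) :
  (forall a : D, (x_ a != 0) || (y_ a != 0) -> f a = 0) -> f = 0.
Proof.
move=> f0; apply: val_inj; apply/funext => a; change (f a = 0).
case: (boolP ((x_ a != 0) || (y_ a != 0))) => [/f0 //|].
rewrite negb_or !negbK => /andP[/eqP xa /eqP ya].
pose v (s : C) : 'rV[C]_3 := \row_i (if i == 0 then s else pt a 0 i).
have vD s : on_D (v s).
  have := pt_on_D a; rewrite /on_D !mxE /=.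
  have -> : pt a 0 0 = 0 by exact: xa.
  have -> : pt a 0 1 = 0 by exact: ya.
  by rewrite !mulr0.
have /asboolP[p pE] := regfunP f.
pose q : {poly C} := mpoly.mmap polyC
  (fun i : 'I_3 => if i == 0 then 'X else (pt a 0 i)%:P) p.
have qE s : q.[s] = f (MkD (vD s)).
  rewrite pE /= mpoly.mevalE /q /mpoly.mmap horner_sum; apply: eq_bigr => m _.
  rewrite hornerM hornerC; congr (_ * _).
  rewrite /mpoly.mmap1 horner_prod; apply: eq_bigr => i _.
  by rewrite horner_exp mxE; case: ifP; rewrite ?hornerX ?hornerC.
have q0 : q = 0.
  apply: poly_vanish => s sN0; rewrite qE f0 //.
  by rewrite /= mxE /= sN0.
have <- : MkD (vD 0) = a.
  apply: val_inj; apply/rowP => i; rewrite mxE; case: eqP => // ->.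
  by rewrite -[LHS]xa.
by rewrite -qE q0 horner0.
Qed.

Lemma omega_unique V W (h : regfun) :
    (forall a, x_ a != 0 -> h a = dwedge x_ z_ V W a / x_ a) ->
    (forall a, y_ a != 0 -> h a = - (dwedge y_ z_ V W a / y_ a)) ->
  h = omega V W.
Proof.
move=> hx hy; apply/subr0_eq/regfun_vanish => a.
rewrite regfunB => /orP[xa|ya].
  by rewrite hx // omegaE_x // subrr.
by rewrite hy // omegaE_y // subrr.
Qed.

Lemma omega_alt V : omega V V = 0.
Proof. by rewrite /omega /dwedge !subrr !mulr0 !addr0 scaler0. Qed.

Lemma omega_anti V W : omega V W = - omega W V.
Proof. by rewrite /omega -scalerN /dwedge; congr (_ *: _); ring. Qed.

Lemma omega_linearl f V V' W :
  omega (fmul f V + V') W = f * omega V W + omega V' W.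
Proof.
rewrite /omega -scalerAr -scalerDr /dwedge !vfieldD /=; congr (_ *: _); ring.
Qed.

(* L_V w is determined by the Leibniz rule
   V (w (W1, W2)) = (L_V w) (W1, W2) + w ([V, W1], W2) + w (W1, [V, W2]). *)
Definition lie_derivative (V : vfield) (w : vfield -> vfield -> regfun)
    (W1 W2 : vfield) : regfun :=
  V (w W1 W2) - w (bracket V W1) W2 - w W1 (bracket V W2).

Definition volume_preserving (V : vfield) : Prop :=
  forall W1 W2, lie_derivative V omega W1 W2 = 0.

(* [phi] is a holomorphic flow of V defined for all complex times and all
   starting points; C^o is C as a normed module over itself, so that is_derive
   is complex differentiation. *)
Definition is_flow (V : vfield) (phi : C -> D -> D) : Prop :=
  forall a : D, phi 0 a = a /\
    forall (i : 'I_3) (t : C),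
      is_derive (t : C^o) (1 : C^o) (fun s : C^o => coord i (phi s a) : C^o)
        (V (coord i) (phi t a)).

Definition completely_integrable (V : vfield) : Prop :=
  exists phi, is_flow V phi.

Definition lie_subalgebra (L : set vfield) : Prop :=
  [/\ L 0,
      forall (c : C) V W, L V -> L W -> L (c *: V + W) &
      forall V W, L V -> L W -> L (bracket V W)].

Definition lie_generated (S : set vfield) : set vfield :=
  smallest lie_subalgebra S.

End Surface.

(* Main.v *)
Require Import Defs.
From mathcomp Require Import all_boot all_order all_algebra ring.
From mathcomp Require Import complex.
From mathcomp Require Import boolp classical_sets functions reals topology.
From mathcomp Require Import normedtype derive.
From mathcomp Require mpoly.
Import (canonicals, coercions) mpoly.

Set Implicit Arguments.
Unset Strict Implicit.
Unset Printing Implicit Defensive.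

Import Order.TTheory GRing.Theory Num.Theory.
Import numFieldNormedType.Exports.

Local Open Scope classical_set_scope.
Local Open Scope complex_scope.
Local Open Scope ring_scope.

(** Every field V that preserves the volume is Hamiltonian: omega (V, W) =
    - W F for a regular function F, because D has no first cohomology. In the
    coordinates the Poisson bracket is that of sl2, {x, y} = 2 z, {x, z} = x,
    {y, z} = - y, and sigma, which maps omega to - omega, turns the Hamiltonian
    F into - F o sigma. So the invariant fields are those of the odd functions
    F, and brackets of fields are Poisson brackets of functions.

    The Hamiltonians x^n and y^n have the fields n x^(n-1) X_x and
    n y^(n-1) X_y. Here X_x kills x, sends z to x and y to 2 z; on each of its
    orbits the factor n x^(n-1) is constant, so the flow is polynomial in the
    time and complete. For odd n these are among the generators, and brackets
    with y lower the exponent of x: {y, x^(i+1) z^j} is a nonzero multiple of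
    x^i z^(j+1) plus a multiple of x^i z^(j-1). Starting from the odd powers of
    x this reaches every odd x^i z^j, in particular the odd powers of z;
    further brackets with y turn z^(i+j) into multiples of y^i z^j. Since
    x y = z^2 - 1, these monomials span the odd functions
    (hamiltonian_in_odd). The semisimple field X_z, whose flow
    is exponential, enters only as a bracket of two nilpotent ones.

    Existence of F (volume_preserving_hamiltonian) is a cocycle computation for
    the weights of the torus field T = X_z, for which x has weight -1, y weight
    1 and z weight 0. Subtracting a Hamiltonian field removes from V z all
    nonzero weights, so that V z = p(z). The invariance of omega then says
    that T + 1 maps V x to x p'(z), an element of its own kernel; as T is
    diagonalizable, this forces p' = 0 and V x = x g(z), and likewise
    V y = y h(z). Tangency, (z^2 - 1) (g + h) = 2 z p, leaves p = 0 and h = - g,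
    and such a field has a primitive of h(z) as Hamiltonian. *)

Lemma is_derive_quadratic (K : numFieldType) (k0 k1 k2 t : K) :
  is_derive (t : K^o) (1 : K^o)
    (fun r : K^o => k0 + k1 * r + k2 * r ^+ 2 : K^o)
    (k1 + 2%:R * k2 * t).
Proof.
have di := is_derive_id (t : K^o) (1 : K^o).
have d2 := is_deriveM di di.
have dZ := is_deriveZ k2 d2.
have d1 := is_deriveZ k1 di.
have d0 := is_derive_cst (k0 : K^o) (t : K^o) (1 : K^o).
have dS := is_deriveD (is_deriveD d0 d1) dZ.
have E : 0 + k1 *: (1 : K^o)
    + k2 *: ((t : K^o) *: (1 : K^o) + (t : K^o) *: (1 : K^o))
    = k1 + 2%:R * k2 * t.
  change (0 + k1 * 1 + k2 * (t * 1 + t * 1) = k1 + 2%:R * k2 * t); ring.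
exact: is_derive_eq dS E.
Qed.

Section Surface.
Variable R : realType.
Local Notation C := R[i].
Local Notation D := (D R).
Local Notation regfun := (regfun R).
Local Notation vfield := (vfield R).
Local Notation coord := (@Defs.coord R).
Local Notation x := (x_ R).
Local Notation y := (y_ R).
Local Notation z := (z_ R).
Implicit Types (a : D) (c t : C) (f g F G : regfun) (U V W : vfield)
  (p q : {poly C}).

(** * Regular functions and vector fields *)

Lemma regfun_ext f g : (forall a, f a = g a) -> f = g.
Proof. by move=> fg; apply: val_inj; apply/funext. Qed.

Lemma regfunD f g a : (f + g) a = f a + g a. Proof. by []. Qed.
Lemma regfunZ c f a : (c *: f) a = c * f a. Proof. by []. Qed.
Lemma regfun1 a : (1 : regfun) a = 1. Proof. by []. Qed.
Lemma regfun0 a : (0 : regfun) a = 0. Proof. by []. Qed.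
Lemma regfunX f n a : (f ^+ n) a = f a ^+ n.
Proof. by elim: n => // n IH; rewrite !exprS regfunM IH. Qed.

Lemma regfun_nat n a : (n%:R : regfun) a = n%:R.
Proof. by elim: n => // n IH; rewrite !mulrSr regfunD IH. Qed.

Lemma scale_nat n f : n%:R *: f = n%:R * f.
Proof. by rewrite scaler_nat mulr_natl. Qed.

Definition linear_pred (P : regfun -> Prop) : Prop :=
  P 0 /\ forall c f g, P f -> P g -> P (c *: f + g).

Lemma linear_predZ P c f : linear_pred P -> P f -> P (c *: f).
Proof. by case=> P0 Pl Pf; rewrite -[_ *: _]addr0; apply: Pl. Qed.

Lemma linear_predD P f g : linear_pred P -> P f -> P g -> P (f + g).
Proof. by case=> P0 Pl Pf Pg; rewrite -[f]scale1r; apply: Pl. Qed.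

Lemma linear_predB P f g : linear_pred P -> P f -> P g -> P (f - g).
Proof. by case=> P0 Pl Pf Pg; rewrite -scaleN1r addrC; apply: Pl. Qed.

Lemma regfun_monomial_ind P : linear_pred P ->
    (forall i j k, P (x ^+ i * y ^+ j * z ^+ k)) -> forall f, P f.
Proof.
move=> [P0 Pl] Pm f; have /asboolP[p pE] := regfunP f.
have -> : f = \sum_(m <- mpoly.msupp p) mpoly.mcoeff m p *:
    (x ^+ m 0 * y ^+ m 1 * z ^+ m (2%:R)).
  apply: regfun_ext => a; rewrite pE mpoly.mevalE.
  elim: (mpoly.msupp p) => [|m s IH]; first by rewrite !big_nil.
  rewrite !big_cons regfunD -IH regfunZ !regfunM !regfunX.
  rewrite !big_ord_recl big_ord0 mulr1 mulrA.
  have -> : lift ord0 ord0 = 1 :> 'I_3 by exact: val_inj.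
  have -> : lift ord0 (lift ord0 ord0) = 2%:R :> 'I_3 by exact: val_inj.
  by rewrite -!mulrA.
elim: (mpoly.msupp p) => [|m s IH]; first by rewrite big_nil.
by rewrite big_cons; apply: Pl.
Qed.

(** Since x y = z^2 - 1, mixed monomials in x and y can be lowered until one of
    the two variables is gone. *)
Lemma regfun_span P : linear_pred P ->
    (forall i j, P (x ^+ i * z ^+ j)) -> (forall i j, P (y ^+ i * z ^+ j)) ->
  forall f, P f.
Proof.
move=> Pl Px Py; apply: regfun_monomial_ind => // i.
elim: i => [|i IH] [|j] k.
- by rewrite mulr1; apply: Px.
- by rewrite mul1r; apply: Py.
- by rewrite mulr1; apply: Px.
have -> : x ^+ i.+1 * y ^+ j.+1 * z ^+ k =
    x ^+ i * y ^+ j * z ^+ k.+2 - x ^+ i * y ^+ j * z ^+ k.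
  rewrite !exprS; transitivity (x ^+ i * y ^+ j * z ^+ k * (x * y));
    first by ring.
  by rewrite xyz_eq; ring.
by apply: linear_predB.
Qed.

Lemma regfun_ind P : linear_pred P -> P 1 ->
    (forall f g, P f -> P g -> P (f * g)) -> (forall i, P (coord i)) ->
  forall f, P f.
Proof.
move=> Pl P1 PM Pc.
have PX f n : P f -> P (f ^+ n).
  by move=> Pf; elim: n => // n IH; rewrite exprS; apply: PM.
apply: regfun_monomial_ind => // i j k.
by apply: (PM _ _ (PM _ _ _ _) _); apply: (PX); apply: Pc.
Qed.

Lemma ord3P (P : 'I_3 -> Prop) : P 0 -> P 1 -> P (2%:R) -> forall i, P i.
Proof.
move=> P0 P1 P2 [[|[|[|//]]] lt_i].
- by rewrite [Ordinal _](_ : _ = 0) //; apply: val_inj.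
- by rewrite [Ordinal _](_ : _ = 1) //; apply: val_inj.
- by rewrite [Ordinal _](_ : _ = 2%:R) //; apply: val_inj.
Qed.

Lemma eq_vfield V U : (forall f, V f = U f) -> V = U.
Proof. by move=> VU; apply: val_inj; apply/funext. Qed.

Lemma vfield_ext V U : V x = U x -> V y = U y -> V z = U z -> V = U.
Proof.
move=> Ex Ey Ez.
apply: eq_vfield; elim/regfun_ind => [||f g Ef Eg|].
- by split=> [|c f g Ef Eg]; rewrite ?linear0 // !vfield_linear Ef Eg.
- by rewrite !vfield1.
- by rewrite !vfieldM Ef Eg.
- exact: ord3P.
Qed.

Lemma vfieldDr V f g : V (f + g) = V f + V g.
Proof. exact: linearD. Qed.

Lemma vfieldNr V f : V (- f) = - V f.
Proof. exact: linearN. Qed.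

Lemma vfieldBr V f g : V (f - g) = V f - V g.
Proof. exact: linearB. Qed.

Lemma vfieldZr V c f : V (c *: f) = c *: V f.
Proof. exact: linearZ. Qed.

Lemma vfield_linr V c f g : V (c *: f + g) = c *: V f + V g.
Proof. exact: linearP. Qed.

Lemma bracketE V U f : bracket V U f = V (U f) - U (V f).
Proof. by []. Qed.

Lemma vfieldX V f n : V (f ^+ n.+1) = n.+1%:R * f ^+ n * V f.
Proof.
elim: n => [|n IH]; first by rewrite expr1 expr0 !mul1r.
by rewrite exprS vfieldM IH exprS; ring.
Qed.

Lemma regfun_double_inj f g : 2%:R * f = 2%:R * g -> f = g.
Proof. by move=> /scale_half <-; rewrite (@scale_half _ g (2%:R * g)). Qed.

(** The functions y and 2 z generate the unit ideal, because z^2 - x y = 1. *)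
Lemma regfun_cancel f g :
  y * f = y * g -> 2%:R * z * f = 2%:R * z * g -> f = g.
Proof.
have E h : 2%:R * (z * (2%:R * z * h) - 2%:R * x * (y * h)) =
    2%:R * (2%:R * h).
  transitivity (2%:R * (2%:R * ((z ^+ 2 - x * y) * h))); first by ring.
  by rewrite xyz_eq opprB addrC subrK mul1r.
by move=> Ey Ez; do 2 apply: regfun_double_inj; rewrite -!E Ey Ez.
Qed.

(** * Hamiltonian vector fields *)

Lemma omega_linear c V U W : omega (c *: V + U) W = c *: omega V W + omega U W.
Proof.
have -> : c *: V = fmul (c%:A) V.
  by apply: val_inj; apply/funext => f /=; rewrite mulr_algl.
by rewrite omega_linearl mulr_algl.
Qed.

Lemma omega0l W : omega 0 W = 0.
Proof.
have zE f : (0 : vfield) f = 0 by [].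
by rewrite /omega /dwedge !zE !(mul0r, mulr0, subr0, addr0, scaler0).
Qed.

(** The evaluation of dx /\ dy /\ dz. *)
Definition det3 V W1 W2 : regfun :=
  V x * dwedge y z W1 W2 - W1 x * dwedge y z V W2 + W2 x * dwedge y z V W1.

(** The 3-form dx /\ dy /\ dz vanishes on a surface: tangency is a linear
    relation between the columns with coefficients y, x, - 2 z, so Cramer's rule
    kills the determinant after multiplication by y and by 2 z. *)
Lemma det3_eq0 V W1 W2 : det3 V W1 W2 = 0.
Proof.
rewrite /det3 /dwedge.
apply: regfun_cancel; rewrite mulr0.
  have t U : y * U x = 2%:R * z * U z - x * U y.
    by rewrite -vfield_tangent; ring.
  transitivity ((y * V x) * (W1 y * W2 z - W2 y * W1 z)
    - (y * W1 x) * (V y * W2 z - W2 y * V z)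
    + (y * W2 x) * (V y * W1 z - W1 y * V z)); first by ring.
  by rewrite !t; ring.
have t U : 2%:R * z * U z = U x * y + x * U y by rewrite vfield_tangent.
transitivity (V x * (W1 y * (2%:R * z * W2 z) - W2 y * (2%:R * z * W1 z))
  - W1 x * (V y * (2%:R * z * W2 z) - W2 y * (2%:R * z * V z))
  + W2 x * (V y * (2%:R * z * W1 z) - W1 y * (2%:R * z * V z)));
  first by ring.
by rewrite !t; ring.
Qed.

Lemma double_omega V W : 2%:R * omega V W =
  z * dwedge x y V W + x * dwedge y z V W + y * dwedge z x V W.
Proof. by rewrite -[RHS](scale_half erefl) -scalerAr. Qed.

Lemma vfield_double V f : V (2%:R * f) = 2%:R * V f.
Proof. by rewrite !mulr_natl linearMn. Qed.

(** The polynomial expression of 2 omega has exterior derivative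
    3 dx /\ dy /\ dz, which is zero on D. *)
Lemma omega_closed V W1 W2 :
  V (omega W1 W2) - W1 (omega V W2) + W2 (omega V W1)
  - omega (bracket V W1) W2 + omega (bracket V W2) W1
  - omega (bracket W1 W2) V = 0.
Proof.
apply: regfun_double_inj; rewrite mulr0 -[RHS](mulr0 3%:R) -(det3_eq0 V W1 W2).
transitivity (V (2%:R * omega W1 W2) - W1 (2%:R * omega V W2)
  + W2 (2%:R * omega V W1) - 2%:R * omega (bracket V W1) W2
  + 2%:R * omega (bracket V W2) W1 - 2%:R * omega (bracket W1 W2) V).
  by rewrite !vfield_double; ring.
rewrite !double_omega /det3 /dwedge.
rewrite !(vfieldDr, vfieldNr, vfieldM, bracketE); ring.
Qed.

(** With this sign V G is the Poisson bracket {F, G}, see hamiltonian_bracket. A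
    relation rather than a function, since F has no distinguished polynomial
    representative from which to compute V. *)
Definition hamiltonian F V : Prop := forall W, omega V W = - W F.

Lemma hamiltonian_linear c F V G U : hamiltonian F V -> hamiltonian G U ->
  hamiltonian (c *: F + G) (c *: V + U).
Proof.
by move=> hF hG W; rewrite omega_linear hF hG vfield_linear scalerN opprD.
Qed.

Lemma hamiltonian_cst c : hamiltonian c%:A 0.
Proof. by move=> W; rewrite omega0l vfieldZr vfield1 scaler0 oppr0. Qed.

Lemma hamiltonian0 : hamiltonian 0 0.
Proof. by rewrite -(scale0r (1 : regfun)); apply: hamiltonian_cst. Qed.

Lemma hamiltonianM F V G U : hamiltonian F V -> hamiltonian G U ->
  hamiltonian (F * G) (fmul F U + fmul G V).
Proof.
move=> hF hG W; rewrite omega_linearl -[fmul G V]addr0 omega_linearl omega0l.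
by rewrite hF hG vfieldM; ring.
Qed.

Lemma hamiltonian_anti F V G U : hamiltonian F V -> hamiltonian G U ->
  V G = - U F.
Proof. by move=> hF hG; rewrite -hF omega_anti hG opprK. Qed.

(** Cartan's formula: the Lie derivative of omega along V is the differential of
    the exact form - dF. *)
Lemma hamiltonian_volume_preserving F V :
  hamiltonian F V -> volume_preserving V.
Proof.
move=> hF W1 W2; rewrite /lie_derivative -[RHS](omega_closed V W1 W2).
rewrite (omega_anti (bracket W1 W2) V) (omega_anti W1 (bracket V W2)) !hF.
by rewrite bracketE !vfieldNr; ring.
Qed.

Lemma volume_preservingP V : volume_preserving V <-> forall W1 W2,
  V (omega W1 W2) = omega (bracket V W1) W2 + omega W1 (bracket V W2).
Proof.
split=> vV W1 W2; last by rewrite /lie_derivative vV; ring.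
by have := vV W1 W2; rewrite /lie_derivative -addrA -opprD => /subr0_eq.
Qed.

(** Transporting the form - dG by the flow of V, which preserves omega, gives
    the form - d (V G). *)
Lemma hamiltonian_bracket V G U : volume_preserving V -> hamiltonian G U ->
  hamiltonian (V G) (bracket V U).
Proof.
move=> /volume_preservingP vV hG W; apply: (addIr (omega U (bracket V W))).
by rewrite -vV !hG bracketE vfieldNr; ring.
Qed.

Lemma volume_preserving_linear c V U :
  volume_preserving V -> volume_preserving U -> volume_preserving (c *: V + U).
Proof.
move=> /volume_preservingP vV /volume_preservingP vU.
apply/volume_preservingP => W1 W2.
have brP W : bracket (c *: V + U) W = c *: bracket V W + bracket U W.
  apply: eq_vfield => f; change ((c *: V + U) (W f) - W (c *: V f + U f) =
    c *: (V (W f) - W (V f)) + (U (W f) - W (U f))).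
  by rewrite vfield_linear scalerBr opprD addrACA.
rewrite vfieldD vfieldZ vV vU !brP !(omega_anti W1) !omega_linear.
by rewrite scalerDr scalerN opprD addrACA.
Qed.

Lemma volume_preserving_bracket V U :
  volume_preserving V -> volume_preserving U ->
  volume_preserving (bracket V U).
Proof.
move=> /volume_preservingP vV /volume_preservingP vU.
apply/volume_preservingP => W1 W2.
have jac W : bracket (bracket V U) W =
    -1 *: bracket U (bracket V W) + bracket V (bracket U W).
  apply: eq_vfield => f; rewrite scaleN1r.
  change (V (U (W f)) - U (V (W f)) - W (V (U f) - U (V f)) =
    - (U (V (W f) - W (V f)) - (V (W (U f)) - W (V (U f))))
    + (V (U (W f) - W (U f)) - (U (W (V f)) - W (U (V f))))).
  by rewrite !vfieldBr; ring.
rewrite bracketE vU vV !vfieldDr !vV !vU !jac !(omega_anti W1) !omega_linear.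
rewrite !scaleN1r.
by rewrite !(omega_anti _ W1); ring.
Qed.

Lemma volume_preserving0 : volume_preserving (0 : vfield).
Proof. exact: hamiltonian_volume_preserving hamiltonian0. Qed.

(** * Two locally nilpotent fields and their flows *)

Lemma poly_ext p q : (forall t, p.[t] = q.[t]) -> p = q.
Proof.
move=> pq; apply/subr0_eq/poly_vanish => t _.
by rewrite hornerD hornerN pq subrr.
Qed.

Section Velocity.
Variables (gamma : C -> D -> D) (v : 'I_3 -> regfun).
Hypothesis gamma0 : forall a, gamma 0 a = a.

(** The derivative at time 0 along the curves gamma, read off as the linear
    coefficient of a polynomial. Going through values at points makes it depend
    on f only, not on a polynomial representing f. *)
Definition velocity f g : Prop := forall a, exists2 q : {poly C},
  forall t, q.[t] = f (gamma t a) & q`_1 = g a.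

Lemma velocity_fun f g1 g2 : velocity f g1 -> velocity f g2 -> g1 = g2.
Proof.
move=> v1 v2; apply: regfun_ext => a.
have [[q1 E1 <-] [q2 E2 <-]] := (v1 a, v2 a).
by rewrite (@poly_ext q1 q2) // => t; rewrite E1 E2.
Qed.

Lemma velocity_linear c f1 g1 f2 g2 : velocity f1 g1 -> velocity f2 g2 ->
  velocity (c *: f1 + f2) (c *: g1 + g2).
Proof.
move=> v1 v2 a; have [[q1 E1 E1'] [q2 E2 E2']] := (v1 a, v2 a).
exists (c *: q1 + q2) => [t|]; first by rewrite hornerD hornerZ E1 E2.
by rewrite coefD coefZ E1' E2'.
Qed.

Lemma velocityM f1 g1 f2 g2 : velocity f1 g1 -> velocity f2 g2 ->
  velocity (f1 * f2) (g1 * f2 + f1 * g2).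
Proof.
move=> v1 v2 a; have [[q1 E1 E1'] [q2 E2 E2']] := (v1 a, v2 a).
exists (q1 * q2) => [t|]; first by rewrite hornerM E1 E2.
rewrite coefM big_ord_recl big_ord1 /= E1' E2' -!horner_coef0 E1 E2 gamma0.
by rewrite addrC.
Qed.

Lemma velocity_total f : (forall i, velocity (coord i) (v i)) ->
  exists g, velocity f g.
Proof.
move=> vc; elim/regfun_ind: f => [||f1 f2 [g1 v1] [g2 v2]|i].
- split=> [|c f1 f2 [g1 v1] [g2 v2]].
    by exists 0 => a; exists 0 => [t|]; rewrite ?horner0 ?coef0.
  by exists (c *: g1 + g2); apply: velocity_linear.
- by exists 0 => a; exists 1 => [t|]; rewrite ?hornerC ?coefC.
- by exists (g1 * f2 + f1 * g2); apply: velocityM.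
- by exists (v i); apply: vc.
Qed.

(** Polynomial curves through every point define a derivation of the coordinate
    ring. This replaces the verification that a derivation of the polynomial
    ring preserves the ideal of D. *)
Lemma vfield_of_curves : (forall i, velocity (coord i) (v i)) ->
  exists V, forall i, V (coord i) = v i.
Proof.
move=> vc; pose V0 f := sval (cid (velocity_total f vc)).
have V0P f : velocity f (V0 f) by rewrite /V0; case: cid.
have V0_der : V0 \in @derivation_pred R.
  apply/asboolP; split=> [c f g|f g]; apply: velocity_fun (V0P _) _.
    exact: velocity_linear.
  exact: velocityM.
by exists (MkVfield V0_der) => i; apply: velocity_fun (V0P _) (vc i).
Qed.

End Velocity.

(** The boolean b selects one of the two symmetric cases: the coordinate fixed
    by the shear is x for false and y for true. *)
Definition axis (b : bool) : 'I_3 := if b then 1 else 0.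

Lemma axis_neq b : (axis (~~ b) == axis b) = false. Proof. by case: b. Qed.
Lemma axis_neq2 b : (2%:R == axis b) = false. Proof. by case: b. Qed.

(** The exponential of t N, where N sends x to 0, z to x and y to 2 z, with x
    and y exchanged when b is true. *)
Definition shear_pt b t a : 'rV[C]_3 :=
  \row_i (if i == axis b then coord (axis b) a
          else if i == axis (~~ b) then
            coord (axis (~~ b)) a + 2%:R * t * z a + t ^+ 2 * coord (axis b) a
          else z a + t * coord (axis b) a).

Lemma shear_on_D b t a : on_D (shear_pt b t a).
Proof.
have := pt_on_D a; rewrite /on_D !mxE => /eqP.
case: b => /=; move: (pt a 0 0) (pt a 0 1) (pt a 0 2%:R) => u v w E; apply/eqP.
  transitivity (u * v + 2%:R * t * w * v + t ^+ 2 * v ^+ 2); first by ring.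
  by rewrite E; ring.
transitivity (u * v + 2%:R * t * w * u + t ^+ 2 * u ^+ 2); first by ring.
by rewrite E; ring.
Qed.

Definition shear b t a : D := MkD (shear_on_D b t a).

Lemma shear_axis b t a : coord (axis b) (shear b t a) = coord (axis b) a.
Proof. by rewrite /= mxE eqxx. Qed.

Lemma shear_coaxis b t a : coord (axis (~~ b)) (shear b t a) =
  coord (axis (~~ b)) a + 2%:R * t * z a + t ^+ 2 * coord (axis b) a.
Proof. by rewrite /= mxE; case: b. Qed.

Lemma shear_z b t a : z (shear b t a) = z a + t * coord (axis b) a.
Proof. by rewrite /= mxE; case: b. Qed.

Lemma axis_ind b (P : 'I_3 -> Prop) :
  P (axis b) -> P (axis (~~ b)) -> P (2%:R) -> forall i, P i.
Proof. by case: b => /= P1 P0 P2; apply: ord3P. Qed.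

Lemma D_ext a1 a2 : (forall i, coord i a1 = coord i a2) -> a1 = a2.
Proof. by move=> E; apply: val_inj; apply/rowP => i; exact: E. Qed.

Lemma shear0 b a : shear b 0 a = a.
Proof.
apply: D_ext; apply: (@axis_ind b).
- by rewrite shear_axis.
- by rewrite shear_coaxis; ring.
- by rewrite [LHS]shear_z; change (coord 2%:R) with z; ring.
Qed.

Lemma shear_vfield_exists b : exists V : vfield,
  [/\ V (coord (axis b)) = 0, V (coord (axis (~~ b))) = 2%:R * z
    & V z = coord (axis b)].
Proof.
pose v i := if i == axis b then 0 else
  if i == axis (~~ b) then 2%:R * z else coord (axis b).
have [|V VE] := @vfield_of_curves (shear b) v (shear0 b).
  apply: (@axis_ind b) => a; rewrite /v.
  - exists (coord (axis b) a)%:P => [t|]; first by rewrite hornerC shear_axis.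
    by rewrite coefC eqxx.
  - exists ((coord (axis (~~ b)) a)%:P + (2%:R * z a)%:P * 'X
      + (coord (axis b) a)%:P * 'X ^+ 2) => [t|].
      by rewrite !(hornerD, hornerM, hornerC, hornerXn, hornerX) shear_coaxis;
        ring.
    rewrite !coefD coefMX coefCM coefXn !coefC /=.
    by rewrite axis_neq eqxx mulr0 addr0 add0r.
  - exists ((z a)%:P + (coord (axis b) a)%:P * 'X) => [t|].
      by rewrite !(hornerD, hornerM, hornerC, hornerX) [RHS]shear_z; ring.
    by rewrite coefD coefMX !coefC /= add0r !axis_neq2.
exists V; split; first by rewrite VE /v eqxx.
  by rewrite VE /v axis_neq eqxx.
by rewrite [LHS]VE /v !axis_neq2.
Qed.

Definition shear_field b : vfield := sval (cid (shear_vfield_exists b)).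

Lemma shear_field_axis b : shear_field b (coord (axis b)) = 0.
Proof. by rewrite /shear_field; case: cid => V []. Qed.

Lemma shear_field_coaxis b :
  shear_field b (coord (axis (~~ b))) = 2%:R * z.
Proof. by rewrite /shear_field; case: cid => V []. Qed.

Lemma shear_field_z b : shear_field b z = coord (axis b).
Proof. by rewrite /shear_field; case: cid => V []. Qed.

Lemma fmulE f V g : fmul f V g = f * V g. Proof. by []. Qed.

Definition shear_power b n : vfield :=
  fmul (n.+1%:R * coord (axis b) ^+ n) (shear_field b).

(** The exchange of x and y reverses omega, whence the sign for b = true. *)
Lemma shear_field_hamiltonian b :
  hamiltonian ((if b then -1 else 1) *: coord (axis b)) (shear_field b).
Proof.
have N0 := shear_field_axis b; have N1 := shear_field_coaxis b.
have N2 := shear_field_z b.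
move: (shear_field b) N0 N1 N2 => N; case: b => /= N0 N1 N2 W;
  rewrite ?scaleN1r ?scale1r ?vfieldNr; apply: regfun_cancel.
- by rewrite mul_y_omega /dwedge [N y]N0 N2 /=; change (coord 1) with y; ring.
- rewrite mul_z_omega /dwedge [N y]N0 [N x]N1; change (coord 1) with y; ring.
- rewrite mul_y_omega /dwedge [N y]N1 N2; change (coord 0) with x.
  transitivity (W y * x - (2%:R * z * W z)); first by ring.
  by rewrite -vfield_tangent; ring.
- rewrite mul_z_omega /dwedge [N y]N1 [N x]N0; change (coord 0) with x; ring.
Qed.

Lemma shear_power_hamiltonian b n : hamiltonian
  ((if b then -1 else 1) *: coord (axis b) ^+ n.+1) (shear_power b n).
Proof.
move=> W; rewrite /shear_power -[fmul _ _]addr0 omega_linearl omega0l addr0.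
rewrite shear_field_hamiltonian !vfieldZr vfieldX; case: b => /=;
  rewrite ?scaleN1r ?scale1r; ring.
Qed.

(** The coefficient of the shear field is constant along its orbits, so the flow
    is the shear with time rescaled by this constant, and its coordinates are
    at most quadratic in the time. *)
Lemma shear_power_complete b n : completely_integrable (shear_power b n).
Proof.
pose s a := n.+1%:R * coord (axis b) a ^+ n.
have s_shear t a : s (shear b t a) = s a by rewrite /s shear_axis.
have sE a : (n.+1%:R * coord (axis b) ^+ n) a = s a.
  by rewrite regfunM regfunX regfun_nat.
exists (fun t a => shear b (t * s a) a) => a; split=> [|i t].
  by rewrite mul0r shear0.
pose P i := is_derive (t : C^o) (1 : C^o)
  (fun r : C^o => coord i (shear b (r * s a) a) : C^o)
  (s a * shear_field b (coord i) (shear b (t * s a) a)).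
have suffP : P i -> is_derive (t : C^o) (1 : C^o)
    (fun r : C^o => coord i (shear b (r * s a) a) : C^o)
    (shear_power b n (coord i) (shear b (t * s a) a)).
  by rewrite /P /shear_power fmulE regfunM sE s_shear.
have quad k0 k1 k2 : (forall r, coord i (shear b (r * s a) a) =
    k0 + k1 * r + k2 * r ^+ 2) -> k1 + 2%:R * k2 * t =
    s a * shear_field b (coord i) (shear b (t * s a) a) -> P i.
  move=> cE dE; rewrite /P -dE.
  have -> : (fun r : C^o => coord i (shear b (r * s a) a) : C^o) =
    (fun r : C^o => k0 + k1 * r + k2 * r ^+ 2 : C^o) by apply/funext.
  exact: is_derive_quadratic.
apply: suffP; move: i @P quad; apply: (@axis_ind b) => P quad.
- apply: (quad (coord (axis b) a) 0 0) => [r|].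
    by rewrite shear_axis; ring.
  by rewrite shear_field_axis regfun0; ring.
- apply: (quad (coord (axis (~~ b)) a) (s a * (2%:R * z a))
    (s a ^+ 2 * coord (axis b) a)) => [r|].
    by rewrite shear_coaxis; ring.
  by rewrite shear_field_coaxis regfunM regfun_nat shear_z; ring.
- apply: (quad (z a) (s a * coord (axis b) a) 0) => [r|].
    by rewrite [LHS]shear_z; ring.
  by rewrite [shear_field b _]shear_field_z shear_axis; ring.
Qed.

(** * Hamiltonians of the coordinates and of functions of z *)

Local Notation Nx := (shear_field false).
Local Notation Ny := (shear_field true).

Lemma shear_x : [/\ Nx x = 0, Nx y = 2%:R * z & Nx z = x].
Proof.
by split; [exact: (shear_field_axis false) | exact: (shear_field_coaxis false)
  | exact: (shear_field_z false)].
Qed.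

Lemma shear_y : [/\ Ny y = 0, Ny x = 2%:R * z & Ny z = y].
Proof.
by split; [exact: (shear_field_axis true) | exact: (shear_field_coaxis true)
  | exact: (shear_field_z true)].
Qed.

Lemma hamiltonian_x : hamiltonian x Nx.
Proof. by have := shear_field_hamiltonian false; rewrite scale1r. Qed.

Lemma hamiltonian_Ny : hamiltonian (- y) Ny.
Proof. by have := shear_field_hamiltonian true; rewrite scaleN1r. Qed.

Lemma hamiltonianZ c F V : hamiltonian F V -> hamiltonian (c *: F) (c *: V).
Proof.
by move=> hF; have := hamiltonian_linear c hF hamiltonian0; rewrite !addr0.
Qed.

Lemma hamiltonianN F V : hamiltonian F V -> hamiltonian (- F) (- V).
Proof.
by move=> hF; rewrite -(scaleN1r F) -(scaleN1r V); apply: hamiltonianZ.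
Qed.

(** Up to the factor - 1/2 this is the bracket of the two shear fields, as in
    sl2, where the bracket of two opposite nilpotent elements is semisimple. *)
Lemma torus_field_exists : exists V,
  [/\ V x = - x, V y = y, V z = 0 & hamiltonian z V].
Proof.
have [Nxx Nxy Nxz] := shear_x; have [Nyy Nyx Nyz] := shear_y.
exists (- 2%:R^-1 *: bracket Nx Ny).
split; rewrite ?vfieldZ ?bracketE ?Nxx ?Nxy ?Nxz ?Nyy ?Nyx ?Nyz.
- rewrite vfield_double Nxz linear0 subr0 scaleNr; congr (- _).
  exact: scale_half.
- rewrite vfield_double Nyz linear0 sub0r scaleNr scalerN opprK.
  exact: scale_half.
- by rewrite Nxy subrr scaler0.
have -> : z = - 2%:R^-1 *: (Nx (- y)).
  by rewrite vfieldNr Nxy scaleNr scalerN opprK (scale_half erefl).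
apply: hamiltonianZ; apply: hamiltonian_bracket hamiltonian_Ny.
exact: hamiltonian_volume_preserving hamiltonian_x.
Qed.

Definition torus_field : vfield := sval (cid torus_field_exists).
Local Notation T := torus_field.

Lemma torus_xyz : [/\ T x = - x, T y = y & T z = 0].
Proof. by rewrite /torus_field; case: cid => V []. Qed.

Lemma hamiltonian_z : hamiltonian z T.
Proof. by rewrite /torus_field; case: cid => V []. Qed.

(** By the Leibniz rule for Hamiltonians it is enough to treat the three
    coordinates. *)
Lemma hamiltonian_exists F : exists V, hamiltonian F V.
Proof.
elim/regfun_ind: F => [||F G [V hF] [U hG]|].
- split=> [|c F G [V hF] [U hG]]; first by exists 0; apply: hamiltonian0.
  by exists (c *: V + U); apply: hamiltonian_linear.
- by exists 0; rewrite -[1]scale1r; apply: hamiltonian_cst.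
- by exists (fmul F U + fmul G V); apply: hamiltonianM.
- apply: ord3P; first by exists Nx; apply: hamiltonian_x.
    exists (- Ny); rewrite -[coord 1]opprK.
    exact/hamiltonianN/hamiltonian_Ny.
  by exists T; apply: hamiltonian_z.
Qed.

Lemma hamiltonian_unique F V U : hamiltonian F V -> hamiltonian F U -> V = U.
Proof.
move=> hV hU.
apply: eq_vfield => G; have [W hG] := hamiltonian_exists G.
by rewrite (hamiltonian_anti hV hG) (hamiltonian_anti hU hG).
Qed.

(** Evaluates the invariance of omega under V on two Hamiltonian fields: the map
    that sends F to V F is a 1-cocycle for the Poisson bracket. *)
Lemma volume_preserving_cocycle V F A G B : volume_preserving V ->
  hamiltonian F A -> hamiltonian G B -> V (B F) = B (V F) - A (V G).
Proof.
move=> /volume_preservingP vV hF hG; have := vV A B.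
rewrite (omega_anti (bracket V A)) !hF hG !bracketE !vfieldNr.
rewrite (hamiltonian_anti hF hG) vfieldNr => /eqP; rewrite -subr_eq0 => /eqP E.
by apply: subr0_eq; rewrite -E; ring.
Qed.

Definition poly_z p : regfun := horner_alg z p.

Lemma poly_zD p q : poly_z (p + q) = poly_z p + poly_z q.
Proof. exact: rmorphD. Qed.
Lemma poly_zN p : poly_z (- p) = - poly_z p. Proof. exact: rmorphN. Qed.
Lemma poly_zM p q : poly_z (p * q) = poly_z p * poly_z q.
Proof. exact: rmorphM. Qed.
Lemma poly_zC c : poly_z c%:P = c%:A. Proof. exact: horner_algC. Qed.
Lemma poly_zX : poly_z 'X = z. Proof. exact: horner_algX. Qed.
Lemma poly_zZ c p : poly_z (c *: p) = c *: poly_z p.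
Proof. by rewrite -mul_polyC poly_zM poly_zC mulr_algl. Qed.

Lemma poly_zXn j : poly_z 'X^j = z ^+ j.
Proof. by rewrite /poly_z rmorphXn /= horner_algX. Qed.

Lemma poly_zE p a : poly_z p a = p.[z a].
Proof.
elim/poly_ind: p => [|p c IH]; first by rewrite poly_zC scale0r horner0.
rewrite poly_zD poly_zM poly_zX poly_zC regfunD regfunM IH.
by rewrite regfunZ regfun1 mulr1 hornerD hornerMX hornerC.
Qed.

Lemma vfield_poly_z V p : V (poly_z p) = poly_z p^`() * V z.
Proof.
elim/poly_ind: p => [|p c IH].
  by rewrite deriv0 poly_zC scale0r mul0r linear0.
rewrite derivD derivM derivX derivC addr0 mulr1.
rewrite !poly_zD !poly_zM poly_zX poly_zC.
rewrite vfieldDr vfieldZr vfield1 scaler0 addr0 vfieldM IH; ring.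
Qed.

(** * Volume preserving fields are Hamiltonian *)

Lemma torus_zX j : T (z ^+ j) = 0.
Proof.
have [_ _ Tz] := torus_xyz.
by case: j => [|j]; rewrite ?vfield1 // vfieldX Tz mulr0.
Qed.

Lemma torus_power_x i j : T (x ^+ i * z ^+ j) = - i%:R *: (x ^+ i * z ^+ j).
Proof.
have [Tx _ _] := torus_xyz.
rewrite vfieldM torus_zX mulr0 addr0 scaleNr scale_nat.
by case: i => [|i]; [rewrite expr0 vfield1|rewrite vfieldX Tx exprS]; ring.
Qed.

Lemma torus_power_y i j : T (y ^+ i * z ^+ j) = i%:R *: (y ^+ i * z ^+ j).
Proof.
have [_ Ty _] := torus_xyz.
rewrite vfieldM torus_zX mulr0 addr0 scale_nat.
by case: i => [|i]; [rewrite expr0 vfield1|rewrite vfieldX Ty exprS]; ring.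
Qed.

(** The product of the operators T - c for c in s, which annihilates the
    eigenvectors of T whose weights are in s. *)
Definition kill_weights (s : seq C) f : regfun :=
  foldr (fun c g => T g - c *: g) f s.

Lemma kill_weights_linear s c f g :
  kill_weights s (c *: f + g) = c *: kill_weights s f + kill_weights s g.
Proof.
elim: s => //= d s ->; rewrite vfield_linr scalerBr scalerDr opprD.
by rewrite !scalerA [d * c]mulrC addrACA.
Qed.

Lemma kill_weights_step s c f :
  kill_weights s (T f - c *: f) = T (kill_weights s f) - c *: kill_weights s f.
Proof.
elim: s => //= d s ->; rewrite !vfieldBr !vfieldZr !scalerBr !scalerA.
by rewrite [d * c]mulrC; ring.
Qed.

Lemma kill_weightsC s1 s2 f :
  kill_weights s1 (kill_weights s2 f) = kill_weights s2 (kill_weights s1 f).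
Proof. by elim: s1 => //= c s1 ->; rewrite kill_weights_step. Qed.

Lemma kill_weights_eigen s f mu :
  T f = mu *: f -> kill_weights s f = (\prod_(c <- s) (mu - c)) *: f.
Proof.
move=> Tf; elim: s => [|c s IH] /=; first by rewrite big_nil scale1r.
rewrite IH big_cons vfieldZr Tf !scalerA -scalerBl; congr (_ *: _); ring.
Qed.

Section Weight.
Variable b : bool.
Let mu : C := if b then 1 else -1.
Let u := coord (axis b).

Lemma torus_weight p : T (u * poly_z p) = mu *: (u * poly_z p).
Proof.
have [Tx Ty Tz] := torus_xyz.
rewrite vfieldM vfield_poly_z Tz !mulr0 addr0 /mu /u.
case: b; rewrite /axis; first by rewrite [T _]Ty scale1r.
by rewrite [T _]Tx scaleN1r mulNr.
Qed.

(** The kernel of T - mu consists of the functions u p(z), and f has finitely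
    many weights: killing all of them but mu leaves a function of this kind. *)
Lemma weight_isolate f :
  exists s p, mu \notin s /\ kill_weights s f = u * poly_z p.
Proof.
have other m nu : T m = nu *: m -> mu != nu ->
    exists s p, mu \notin s /\ kill_weights s m = u * poly_z p.
  move=> Tm mu_nu; exists [:: nu], 0; rewrite inE; split=> //=.
  by rewrite Tm subrr -polyC0 poly_zC scale0r mulr0.
elim/regfun_span: f => [|i j|i j].
- split=> [|c f1 f2 [s1 [p1 [Ns1 E1]]] [s2 [p2 [Ns2 E2]]]].
    by exists [::], 0; split; rewrite //= -polyC0 poly_zC scale0r mulr0.
  (* On the eigenspace of mu the factors coming from the other list act by a
     nonzero scalar. *)
  exists (s1 ++ s2).
  exists ((c * \prod_(d <- s2) (mu - d)) *: p1 +
    (\prod_(d <- s1) (mu - d)) *: p2).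
  rewrite mem_cat negb_or Ns1 Ns2; split=> //.
  have -> f : kill_weights (s1 ++ s2) f = kill_weights s1 (kill_weights s2 f)
    by rewrite /kill_weights foldr_cat.
  rewrite !kill_weights_linear E2 kill_weightsC E1.
  rewrite !(kill_weights_eigen _ (torus_weight _)).
  by rewrite poly_zD !poly_zZ mulrDr !scalerA -!scalerAr.
- have Tm := torus_power_x i j.
  case: (eqVneq mu (- i%:R)) => [|/(other _ _ Tm)//].
  rewrite /mu; case: ifP => b_ => [/eqP|].
    by rewrite -addr_eq0 addrC natr1 pnatr_eq0.
  move=> /oppr_inj/eqP; rewrite eq_sym pnatr_eq1 => /eqP ->.
  exists [::], 'X^j; split=> //=.
  by rewrite expr1 /u b_ poly_zXn.
- have Tm := torus_power_y i j; case: (eqVneq mu i%:R) => [|/(other _ _ Tm)//].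
  rewrite /mu; case: ifP => b_ => [/eqP|/eqP].
    rewrite eq_sym pnatr_eq1 => /eqP ->.
    exists [::], 'X^j; split=> //=.
    by rewrite expr1 /u b_ poly_zXn.
  by rewrite eq_sym -addr_eq0 natr1 pnatr_eq0.
Qed.

(** The operator T is diagonalizable, so the kernel of T - mu meets its image
    only in 0. Indeed killing the other weights of f multiplies u r(z) by a
    nonzero number and also makes it zero. *)
Lemma weight_resonance f r : T f - mu *: f = u * poly_z r ->
  u * poly_z r = 0 /\ exists p, f = u * poly_z p.
Proof.
move=> Tf; have [s [p [Ns E]]] := weight_isolate f.
pose k := \prod_(c <- s) (mu - c).
have k0 : k != 0.
  rewrite /k prodf_seq_neq0; apply/allP => c cs /=.
  by rewrite subr_eq0; apply: contra Ns => /eqP ->.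
have r0 : u * poly_z r = 0.
  have : k *: (u * poly_z r) = 0.
    rewrite -(kill_weights_eigen _ (torus_weight _)) -Tf kill_weights_step E.
    rewrite torus_weight.
    exact: subrr.
  by move/eqP; rewrite scaler_eq0 (negPf k0) => /eqP.
split=> //; exists (k^-1 *: p).
rewrite poly_zZ -scalerAr -E (@kill_weights_eigen _ _ mu).
  by rewrite scalerA mulVf ?scale1r.
by apply: subr0_eq; rewrite Tf.
Qed.

End Weight.

(** On the monomials of nonzero weight T is invertible, and those of weight zero
    are the powers of z. *)
Lemma torus_coimage f : exists g p, f = T g + poly_z p.
Proof.
elim/regfun_span: f => [|i j|i j].
- split=> [|c f1 f2 [g1 [p1 ->]] [g2 [p2 ->]]].
    by exists 0, 0; rewrite linear0 -polyC0 poly_zC scale0r addr0.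
  exists (c *: g1 + g2), (c *: p1 + p2).
  by rewrite poly_zD poly_zZ vfield_linr scalerDr addrACA.
- case: i => [|i].
    by exists 0, 'X^j; rewrite linear0 mul1r add0r poly_zXn.
  exists (- (i.+1%:R^-1) *: (x ^+ i.+1 * z ^+ j)), 0.
  rewrite vfieldZr torus_power_x scalerA mulrNN mulVf ?pnatr_eq0 //.
  by rewrite scale1r -polyC0 poly_zC scale0r addr0.
- case: i => [|i].
    by exists 0, 'X^j; rewrite linear0 mul1r add0r poly_zXn.
  exists (i.+1%:R^-1 *: (y ^+ i.+1 * z ^+ j)), 0.
  rewrite vfieldZr torus_power_y scalerA mulVf ?pnatr_eq0 //.
  by rewrite scale1r -polyC0 poly_zC scale0r addr0.
Qed.

Lemma primitive_exists p : exists q : {poly C}, q^`() = p.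
Proof.
exists (\poly_(i < (size p).+1) (p`_i.-1 / i%:R)); apply/polyP => i.
rewrite coef_deriv coef_poly ltnS; case: ltnP => [_|le_p_i].
  by rewrite -[LHS]mulr_natr divfK // pnatr_eq0.
by rewrite mul0rn nth_default.
Qed.

Lemma slice_on_D (s : C) : on_D (\row_i [:: s ^+ 2 - 1; 1; s]`_i).
Proof. by rewrite /on_D !mxE /= mulr1. Qed.

(** A curve on which z takes every value, to turn identities between functions
    p(z) into identities between polynomials. *)
Definition slice s : D := MkD (slice_on_D s).

Lemma sliceE s : [/\ x (slice s) = s ^+ 2 - 1, y (slice s) = 1
  & z (slice s) = s].
Proof. by split; rewrite /= mxE. Qed.

Lemma hamiltonian_poly_z p : hamiltonian (poly_z p) (fmul (poly_z p^`()) T).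
Proof.
move=> W; rewrite -[fmul _ _]addr0 omega_linearl omega0l addr0.
by rewrite hamiltonian_z vfield_poly_z mulrN.
Qed.

(** The weight-zero part of the argument: V x and V y must be x g(z) and y h(z),
    and tangency forces V to be h(z) T. *)
Lemma volume_preserving_poly_z V p : volume_preserving V -> V z = poly_z p ->
  exists F, hamiltonian F V.
Proof.
move=> vV Vz.
have [Tx Ty Tz] := torus_xyz.
have [_ _ Nxz] := shear_x; have [_ _ Nyz] := shear_y.
(* The cocycle identity for the pairs (x, z) and (- y, z). *)
have eqx : T (V x) - (-1) *: V x = x * poly_z p^`().
  have := volume_preserving_cocycle vV hamiltonian_x hamiltonian_z.
  rewrite Tx Vz vfieldNr vfield_poly_z Nxz scaleN1r => /eqP.
  by rewrite -subr_eq0 => /eqP E; apply: subr0_eq; rewrite -oppr0 -E; ring.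
have eqy : T (V y) - 1 *: V y = y * poly_z (- p^`()).
  have := volume_preserving_cocycle vV hamiltonian_Ny hamiltonian_z.
  rewrite !vfieldNr Ty Vz vfield_poly_z Nyz scale1r poly_zN => /eqP.
  by rewrite -subr_eq0 => /eqP E; apply: subr0_eq; rewrite -E; ring.
(* The equation for x also says x p'(z) = 0, so that p is constant. *)
have [p'0 [g Vx]] := @weight_resonance false _ _ eqx.
have [_ [h Vy]] := @weight_resonance true _ _ eqy.
change (V x = x * poly_z g) in Vx; change (V y = y * poly_z h) in Vy.
have X2 : 'X^2 - 1 != 0 :> {poly C}.
  by rewrite -size_poly_eq0 size_XnsubC.
have p_cst : p = (p`_0)%:P.
  have p'z : p^`() = 0.
    apply/eqP; have : ('X^2 - 1) * p^`() == 0.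
      apply/eqP/poly_ext => s; have /(congr1 (fun f => f (slice s))) := p'0.
      have [xs _ zs] := sliceE s.
      rewrite regfunM poly_zE [X in X * _]xs zs regfun0 horner0 => <-.
      by rewrite hornerM hornerD hornerN hornerXn hornerC.
    by rewrite mulf_eq0 (negPf X2).
  apply/polyP => [[|i]]; rewrite coefC //=.
  have := coef_deriv p i; rewrite p'z coef0 => /esym/eqP.
  by rewrite mulrn_eq0 => /eqP.
(* The tangency relation along the slice, where y = 1 and x = s^2 - 1. *)
have tang s : (s ^+ 2 - 1) * (g + h).[s] = 2%:R * s * p`_0.
  have /(congr1 (fun f => f (slice s))) := vfield_tangent V.
  have [xs ys zs] := sliceE s.
  rewrite Vx Vy Vz !(regfun_nat, regfunD, regfunM) !poly_zE xs ys zs hornerD.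
  by rewrite {1}p_cst hornerC => <-; ring.
have c0 : p`_0 = 0.
  have := tang 1; rewrite expr1n subrr mul0r mulr1 => /esym/eqP.
  by rewrite mulf_eq0 pnatr_eq0 => /eqP.
have gh : h = - g.
  apply/eqP; rewrite -addr_eq0 addrC; have : ('X^2 - 1) * (g + h) == 0.
    apply/eqP/poly_ext => s; rewrite hornerM hornerD hornerN hornerXn hornerC.
    by rewrite tang c0 mulr0 horner0.
  by rewrite mulf_eq0 (negPf X2).
have [G GE] := primitive_exists h; exists (poly_z G).
suff -> : V = fmul (poly_z G^`()) T by apply: hamiltonian_poly_z.
apply: vfield_ext; rewrite fmulE GE.
- by rewrite Vx Tx gh poly_zN; ring.
- by rewrite Vy Ty mulrC.
- by rewrite Vz Tz p_cst c0 poly_zC scale0r mulr0.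
Qed.

(** The field V is corrected by a Hamiltonian field U so that (V + U) z is a
    polynomial in z: U z = - T f cancels the nonzero weights of V z. *)
Lemma volume_preserving_hamiltonian V : volume_preserving V ->
  exists F, hamiltonian F V.
Proof.
move=> vV; have [f [p Vz]] := torus_coimage (V z).
have [U hU] := hamiltonian_exists f.
have [F hF] : exists F, hamiltonian F (V + U).
  apply: (@volume_preserving_poly_z _ p).
    rewrite -[V]scale1r; apply: volume_preserving_linear => //.
    exact: hamiltonian_volume_preserving hU.
  rewrite vfieldD Vz (hamiltonian_anti hU hamiltonian_z); ring.
exists (F - f); have := hamiltonian_linear (-1) hU hF.
by rewrite !scaleN1r addrC [_ + (V + U)]addrC addrK.
Qed.

(** * Odd Hamiltonians and the generated Lie algebra *)

Local Notation sig := (@sigma_pull R).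

Lemma sigma_pullZ c f : sig (c *: f) = c *: sig f.
Proof. by apply: regfun_ext. Qed.

Lemma sigma_pullN f : sig (- f) = - sig f.
Proof. by apply: regfun_ext. Qed.

Lemma sigma_pullB f g : sig (f - g) = sig f - sig g.
Proof. by apply: regfun_ext. Qed.

Lemma sigma_pull_coord i : sig (coord i) = - coord i.
Proof. by apply: regfun_ext => a; rewrite /= mxE. Qed.

Lemma sigma_pull_xyz : [/\ sig x = - x, sig y = - y & sig z = - z].
Proof. by split; apply: sigma_pull_coord. Qed.

Lemma sigma_pullX f n : sig (f ^+ n) = sig f ^+ n.
Proof.
elim: n => [|n IH]; first by apply: regfun_ext.
by rewrite !exprS sigma_pullM IH.
Qed.

Lemma sigma_pushE V f : sigma_push V f = sig (V (sig f)).
Proof. by []. Qed.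

Lemma sigma_pushK V : sigma_push (sigma_push V) = V.
Proof. by apply: eq_vfield => f; rewrite !sigma_pushE !sigma_pullK. Qed.

Lemma Z2_invariantP V : Z2_invariant V <-> forall f, V (sig f) = sig (V f).
Proof.
split=> [VE f|VE]; first by rewrite -[in LHS]VE sigma_pushE sigma_pullK.
by apply: eq_vfield => f; rewrite sigma_pushE VE sigma_pullK.
Qed.

Lemma sigma_pull_double f : sig (2%:R * f) = 2%:R * sig f.
Proof. by rewrite !mulr_natl !mulr2n sigma_pullD. Qed.

(** The form omega is odd under sigma, as dx / x is invariant and dz changes
    sign. *)
Lemma omega_sigma_push V W :
  omega (sigma_push V) (sigma_push W) = - sig (omega V W).
Proof.
have [sx sy sz] := sigma_pull_xyz; apply: regfun_double_inj.
rewrite mulrN -sigma_pull_double !double_omega /dwedge !sigma_pushE.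
rewrite sx sy sz !vfieldNr !sigma_pullN.
rewrite !(sigma_pullD, sigma_pullM, sigma_pullN) sx sy sz; ring.
Qed.

Lemma hamiltonian_sigma_push F V :
  hamiltonian F V -> hamiltonian (- sig F) (sigma_push V).
Proof.
move=> hF W; rewrite -{1}[W]sigma_pushK omega_sigma_push hF sigma_pushE.
by rewrite sigma_pullN sigma_pullK vfieldNr.
Qed.

Section Generation.
Variable L : set vfield.
Hypothesis L_lie : lie_subalgebra L.
Hypothesis L_shear : forall b n, ~~ odd n -> L (shear_power b n).

Definition hamiltonian_in F : Prop := exists2 V, hamiltonian F V & L V.

Lemma hamiltonian_in_linear : linear_pred hamiltonian_in.
Proof.
have [L0 Ll _] := L_lie; split; first by exists 0 => //; apply: hamiltonian0.
move=> c F G [V hF LV] [U hG LU]; exists (c *: V + U); last exact: Ll.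
exact: hamiltonian_linear.
Qed.

Lemma hamiltonian_in_Ny F : hamiltonian_in F -> hamiltonian_in (Ny F).
Proof.
have [_ _ Lb] := L_lie; move=> [V hF LV]; exists (bracket Ny V).
  apply: hamiltonian_bracket hF.
  exact: hamiltonian_volume_preserving hamiltonian_Ny.
apply: Lb LV; have -> : Ny = shear_power true 0; last exact: L_shear.
apply: hamiltonian_unique hamiltonian_Ny _.
by have := shear_power_hamiltonian true 0; rewrite scaleN1r expr1.
Qed.

(** Induction on j: the shear along y maps x^(i+1) z^j to
    (2 (i + 1) + j) x^i z^(j+1) - j x^i z^(j-1), which expresses x^i z^(j+1)
    through functions already obtained; all of them are odd. *)
Lemma hamiltonian_in_xz j i : odd (i + j) -> hamiltonian_in (x ^+ i * z ^+ j).
Proof.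
have Pl := hamiltonian_in_linear.
elim/ltn_ind: j i => -[|j] IH i.
  case: i => [//|i]; rewrite addn0 /= mulr1 => Ni.
  exists (shear_power false i); last exact: L_shear.
  by have := shear_power_hamiltonian false i; rewrite scale1r.
move=> odd_ij; have [Nyy Nyx Nyz] := shear_y.
have E : (2 * i.+1 + j)%:R *: (x ^+ i * z ^+ j.+1) =
    Ny (x ^+ i.+1 * z ^+ j) + j%:R *: (x ^+ i * z ^+ j.-1).
  rewrite vfieldM vfieldX Nyx !scale_nat natrD natrM.
  case: j {IH odd_ij} => [|j] /=.
    by rewrite vfield1 !expr0 expr1 exprS; ring.
  rewrite vfieldX Nyz.
  transitivity (i.+1%:R * x ^+ i * (2%:R * z) * z ^+ j.+1 +
    j.+1%:R * x ^+ i * z ^+ j * (x * y) + j.+1%:R * (x ^+ i * z ^+ j)).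
    by rewrite xyz_eq !exprS; ring.
  by rewrite !exprS; ring.
have k0 : (2 * i.+1 + j)%:R != 0 :> C by rewrite pnatr_eq0 mulnS.
rewrite -[_ * _](scale1r) -(mulVf k0) -scalerA E.
apply: linear_predZ => //; apply: linear_predD => //.
  by apply: hamiltonian_in_Ny; apply: IH => //; rewrite addSnnS.
case: j {E k0} IH odd_ij => [|j] IH odd_ij.
  by rewrite scale0r; case: Pl.
apply: linear_predZ => //; apply: IH => //=.
by move: odd_ij; rewrite !addnS /= negbK.
Qed.

(** The shear along y sends y^i z^(j+1) to (j + 1) y^(i+1) z^j, starting from an
    odd power of z. *)
Lemma hamiltonian_in_yz i j : odd (i + j) -> hamiltonian_in (y ^+ i * z ^+ j).
Proof.
elim: i j => [|i IH] j odd_ij.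
  by have := @hamiltonian_in_xz j 0 odd_ij; rewrite !expr0.
have [Nyy _ Nyz] := shear_y.
have -> : y ^+ i.+1 * z ^+ j = j.+1%:R^-1 *: Ny (y ^+ i * z ^+ j.+1).
  have -> : Ny (y ^+ i * z ^+ j.+1) = j.+1%:R *: (y ^+ i.+1 * z ^+ j).
    rewrite vfieldM vfieldX Nyz scale_nat.
    have -> : Ny (y ^+ i) = 0.
      by case: (i) => [|k]; rewrite ?vfield1 // vfieldX Nyy mulr0.
    by rewrite !exprS; ring.
  by rewrite scalerA mulVf ?scale1r // pnatr_eq0.
apply: linear_predZ; first exact: hamiltonian_in_linear.
by apply/hamiltonian_in_Ny/IH; rewrite addnS.
Qed.

(** By linearity F may be a monomial, for which F - sig F is 0 or 2 F according
    to the parity of its degree. *)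
Lemma hamiltonian_in_odd F : hamiltonian_in (F - sig F).
Proof.
have Pl := hamiltonian_in_linear; have [sx sy sz] := sigma_pull_xyz.
have parity f n : sig f = (-1) ^+ n * f -> (odd n -> hamiltonian_in f) ->
    hamiltonian_in (f - sig f).
  move=> -> Hf; rewrite -signr_odd; case: odd Hf => Hf.
    rewrite expr1 mulN1r opprK.
    by apply: linear_predD => //; apply: Hf.
  by rewrite mul1r subrr; case: Pl.
elim/regfun_span: F => [|i j|i j].
- split=> [|c f g Pf Pg].
    by rewrite -(scale0r (0 : regfun)) sigma_pullZ !scale0r subrr; case: Pl.
  rewrite sigma_pullD sigma_pullZ opprD addrACA -scalerBr.
  by case: Pl => _; apply.
- apply: (@parity _ (i + j)); last exact: hamiltonian_in_xz.
  by rewrite sigma_pullM !sigma_pullX sx sz (exprNn x) (exprNn z) exprD; ring.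
- apply: (@parity _ (i + j)); last exact: hamiltonian_in_yz.
  by rewrite sigma_pullM !sigma_pullX sy sz (exprNn y) (exprNn z) exprD; ring.
Qed.

(** If V is invariant, both F and - sig F are Hamiltonians of V, so 2 V is the
    field of F - sig F. *)
Lemma invariant_volume_preserving_in V :
  Z2_invariant V -> volume_preserving V -> L V.
Proof.
move=> VE /volume_preserving_hamiltonian[F hF].
have [U hU LU] := hamiltonian_in_odd F; have [L0 Ll _] := L_lie.
have VV : V + V = U.
  apply: hamiltonian_unique hU; have := hamiltonian_sigma_push hF.
  by rewrite VE => hF'; have := hamiltonian_linear 1 hF hF'; rewrite !scale1r.
have -> : V = 2%:R^-1 *: U + 0; last exact: Ll.
have V2 : V + V = 2%:R *: V by rewrite scaler_nat mulr2n.
by rewrite addr0 -VV V2 scalerA mulVf ?scale1r // pnatr_eq0.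
Qed.

End Generation.

(** The Hamiltonian is a power with odd exponent n + 1, hence an odd function. *)
Lemma shear_power_invariant b n : ~~ odd n -> Z2_invariant (shear_power b n).
Proof.
move=> even_n; have hs := shear_power_hamiltonian b n.
apply: (hamiltonian_unique _ hs); have := hamiltonian_sigma_push hs.
rewrite sigma_pullZ sigma_pullX sigma_pull_coord exprNn -signr_odd /= even_n.
by rewrite expr1 mulN1r scalerN opprK.
Qed.

Lemma invariant_volume_preserving_lie :
  lie_subalgebra [set V : vfield | Z2_invariant V /\ volume_preserving V].
Proof.
split=> [|c V W [/Z2_invariantP Vi Vv] [/Z2_invariantP Wi Wv]
         |V W [/Z2_invariantP Vi Vv] [/Z2_invariantP Wi Wv]].
- split; last exact: volume_preserving0.
  apply/Z2_invariantP => f; rewrite -(scale0r (0 : vfield)) !vfieldZ !scale0r.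
  by apply: regfun_ext.
- split; last exact: volume_preserving_linear.
  apply/Z2_invariantP => f.
  by rewrite !vfieldD !vfieldZ Vi Wi sigma_pullD sigma_pullZ.
- split; last exact: volume_preserving_bracket.
  by apply/Z2_invariantP => f; rewrite !bracketE Vi Wi Wi Vi sigma_pullB.
Qed.

End Surface.

Theorem theorem3p6 (R : realType) :
  lie_generated [set V : vfield R |
    [/\ Z2_invariant V, completely_integrable V & volume_preserving V]] =
  [set V : vfield R | Z2_invariant V /\ volume_preserving V].
Proof.
apply/seteqP; split.
  apply: smallest_sub => [|V [Vi _ Vv]]; last by split.
  exact: invariant_volume_preserving_lie.
move=> V [Vi Vv] L [L_lie L_gen].
apply: invariant_volume_preserving_in Vi Vv => // b n even_n; apply: L_gen.
split; first exact: shear_power_invariant.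
  exact: shear_power_complete.
exact: hamiltonian_volume_preserving (@shear_power_hamiltonian R b n).
Qed.
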